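(* Let $\alpha \in [0,1]$ and $\varepsilon \in (0, 1/2)$. There exists an algorithm that makes $O(\sqrt{n} \cdot \log\log n \cdot \mathrm{poly}(1/\varepsilon))$ degree queries and uniformly random neighbor queries to an $\alpha$-erased $n$-vertex input graph of average degree $\overline{d}\geq 1$ and outputs, with probability at least $2/3$, an estimate $\widetilde{d}$ satisfying $$(1-\varepsilon) \cdot \overline{d} < \widetilde{d} < \big(1 + 2 \min(\alpha, \tfrac{1}{2}) + \varepsilon\big) \cdot \overline{d}.$$ The running time of the algorithm is the same as its query complexity.
   Context: Graphs are simple and undirected, on a vertex set $V$ with $n=|V|$, represented by adjacency lists. For $\alpha\in[0,1]$, an $\alpha$-erased graph is the concatenation of the adjacency lists of a simple undirected graph $(V,E)$ in which at most $2\alpha|E|$ entries have been replaced by a special symbol $\bot$ (erased). $m$ denotes half the total length of all adjacency lists and $\overline{d}=2m/n$ is the average degree. A degree query on $v$ returns the length $\deg(v)$ of the adjacency list of $v$; a uniformly random neighbor query on $v$ returns a uniformly random entry of the adjacency list of $v$ (which may be $\bot$). *)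

(* Defs.v *)
From HB Require Import structures.
From mathcomp Require Import all_boot all_order all_algebra.
From mathcomp Require Import all_classical all_reals all_analysis.

Set Implicit Arguments.
Unset Strict Implicit.
Unset Printing Implicit Defensive.

Import Order.TTheory GRing.Theory Num.Theory.

Local Open Scope ring_scope.

(** * Erased graphs *)

Definition simple_graph (n : nat) (e : rel 'I_n) : Prop :=
  symmetric e /\ irreflexive e.

Definition edge_count (n : nat) (e : rel 'I_n) : nat :=
  #|[set p : 'I_n * 'I_n | (p.1 < p.2)%N && e p.1 p.2]|.

Definition adjacency_lists (n : nat) (e : rel 'I_n) (L : 'I_n -> seq 'I_n) : Prop :=
  forall v, uniq (L v) /\ forall u, (u \in L v) = e v u.

(* Entries of type [option 'I_n]; [None] is the erased symbol. *)
Definition partly_erased (n : nat) (L : 'I_n -> seq 'I_n)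
    (A : 'I_n -> seq (option 'I_n)) : Prop :=
  forall v, all2 (fun a u => (a == None) || (a == Some u)) (A v) (L v).

Definition erased_count (n : nat) (A : 'I_n -> seq (option 'I_n)) : nat :=
  (\sum_(v < n) count_mem None (A v))%N.

Definition erased_graph (R : realType) (alpha : R) (n : nat)
    (A : 'I_n -> seq (option 'I_n)) : Prop :=
  exists (e : rel 'I_n) (L : 'I_n -> seq 'I_n),
    [/\ simple_graph e, adjacency_lists e L, partly_erased L A
      & (erased_count A)%:R <= 2 * alpha * (edge_count e)%:R].

Definition half_length (R : realType) (n : nat) (A : 'I_n -> seq (option 'I_n)) : R :=
  (\sum_(v < n) size (A v))%:R / 2.

Definition avg_degree (R : realType) (n : nat) (A : 'I_n -> seq (option 'I_n)) : R :=
  2 * half_length R A / n%:R.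

(** * Randomized word RAM with oracle access to an erased graph

    Memory cells hold words, i.e. naturals below [W]; every value is reduced
    modulo [W] when it is written.  The [nat] arguments of instructions are
    addresses of memory cells, except for the constant of [Const].  Every
    instruction, every query and every evaluation of a guard takes one unit
    of time. *)

Inductive binop := Add | Sub | Mul | Div.

Definition eval_binop (o : binop) : nat -> nat -> nat :=
  match o with Add => addn | Sub => subn | Mul => muln | Div => divn end.

Inductive cmd :=
| Const of nat & nat                     (* M[x] := c *)
| Bin of binop & nat & nat & nat         (* M[x] := M[y] o M[z] *)
| Fetch of nat & nat                      (* M[x] := M[M[y]] *)
| Store of nat & nat                     (* M[M[x]] := M[y] *)
| Rand of nat & nat                      (* M[x] := uniform in {0..M[y]-1} *)
| DegQuery of nat & nat                  (* M[x] := deg(M[y]) *)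
| NbrQuery of nat & nat                  (* M[x] := random entry of list M[y] *)
| If of nat & nat & seq cmd & seq cmd    (* if M[x] < M[y] then .. else .. *)
| While of nat & nat & seq cmd.          (* while M[x] < M[y] do .. *)

Definition program := seq cmd.

(* [code] is the part of the program still to be executed. *)
Record config := Config {
  code : program;
  mem : nat -> nat;
  queries : nat }.

Definition halted (c : config) : bool := nilp (code c).

Definition write (W : nat) (M : nat -> nat) (x v : nat) : nat -> nat :=
  fun y => if y == x then (v %% W)%N else M y.

(* Words that are not vertices are given the empty list. *)
Definition list_of (n : nat) (A : 'I_n -> seq (option 'I_n)) (v : nat) :
    seq (option 'I_n) :=
  if insub v is Some i then A i else [::].

(* The erased symbol is answered as 0, and vertex u as u + 1. *)
Definition word_of_entry (n : nat) (a : option 'I_n) : nat :=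
  if a is Some u then u.+1 else 0%N.

(* A neighbor query on an empty list, which has no entry, is answered by 0. *)
Definition nbr_answers (n : nat) (A : 'I_n -> seq (option 'I_n)) (v : nat) : seq nat :=
  if list_of A v is [::] then [:: 0%N] else map (@word_of_entry n) (list_of A v).

Definition rand_answers (k : nat) : seq nat :=
  if k is 0 then [:: 0%N] else iota 0 k.

(* The nonempty list, with multiplicities, of the equally likely successors. *)
Definition step (W n : nat) (A : 'I_n -> seq (option 'I_n)) (c : config) : seq config :=
  let: Config p M q := c in
  if p is i :: p' then
    match i with
    | Const x k => [:: Config p' (write W M x k) q]
    | Bin o x y z => [:: Config p' (write W M x (eval_binop o (M y) (M z))) q]
    | Fetch x y => [:: Config p' (write W M x (M (M y))) q]
    | Store x y => [:: Config p' (write W M (M x) (M y)) q]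
    | Rand x y => [seq Config p' (write W M x r) q | r <- rand_answers (M y)]
    | DegQuery x y => [:: Config p' (write W M x (size (list_of A (M y)))) q.+1]
    | NbrQuery x y => [seq Config p' (write W M x r) q.+1 | r <- nbr_answers A (M y)]
    | If x y p1 p2 => [:: Config ((if (M x < M y)%N then p1 else p2) ++ p') M q]
    | While x y b => [:: Config (if (M x < M y)%N then b ++ p else p') M q]
    end
  else [:: c].

(* The size of the graph is given in cell 0; all other cells are 0. *)
Definition initial (W n : nat) (p : program) : config :=
  Config p (write W (fun=> 0%N) 0 n) 0.

(* The (rational) output is the quotient of the contents of cells 0 and 1. *)
Definition output (R : realType) (c : config) : R := (mem c 0)%:R / (mem c 1)%:R.

(* [E] holds after [t] steps, whatever the coin tosses and the answers. *)
Fixpoint surely (W n : nat) (A : 'I_n -> seq (option 'I_n)) (E : config -> bool)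
    (t : nat) (c : config) : bool :=
  if t is t'.+1 then all (surely W A E t') (step W A c) else E c.

(* The probability that [E] holds after [t] steps. *)
Fixpoint prob (R : realType) (W n : nat) (A : 'I_n -> seq (option 'I_n))
    (E : config -> bool) (t : nat) (c : config) : R :=
  if t is t'.+1 then
    (\sum_(c' <- step W A c) prob R W A E t' c') / (size (step W A c))%:R
  else (E c)%:R.

(** * Asymptotics *)

Definition log2 (R : realType) (x : R) : R := ln x / ln 2.

(* [C * sqrt n * log log n * (1/eps)^k]; the maximum, which only matters for
   n < 4, keeps log log n from vanishing or being ill-defined. *)
Definition complexity_bound (R : realType) (C : R) (k n : nat) (eps : R) : R :=
  C * Num.sqrt n%:R * Num.max 1 (log2 (log2 n%:R)) * (1 / eps) ^+ k.

(* Main.v *)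
Require Import Defs.
From HB Require Import structures.
From mathcomp Require Import all_boot all_order all_algebra.
From mathcomp Require Import all_classical all_reals all_analysis.
From mathcomp Require Import ring lra zify.

(** Draw a uniform vertex [v] and a uniform entry of its list.  Weigh the draw by
    [2 deg v] if the entry is erased; if it is [u], by [deg v] times 2, 1 or 0
    according to whether [deg v] is less than, equal to or greater than [deg u].
    Intact edges then contribute exactly their two endpoints, and an erased entry
    adds at most 2, so the mean lies between [d] and [(1 + 2 min(alpha, 1/2)) d].
    The variance may be huge because of erased lists of heavy vertices, so a round,
    of about [sqrt n] draws, is only known by Markov's inequality not to exceed the
    upper bound with probability of order [eps].  It is almost never too small:
    dropping the vertices of degree above [tau = 2 sqrt n d / eps] loses only edges
    inside a set of at most [n d / tau] vertices, a negligible number, and bounds the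
    variance by [O(tau d)], to which Chebyshev's inequality applies.  Hence the least
    average over [O(1 / eps)] rounds is a good estimate. *)

Set Implicit Arguments.
Unset Strict Implicit.
Unset Printing Implicit Defensive.

Import Order.TTheory GRing.Theory Num.Theory.

Local Open Scope ring_scope.

(** * Expectations *)

Section Expectation.
Variable R : realType.

(** A distribution is encoded by the functional it induces on real functions: the law of a
    randomized program is a nest of finite averages, and such functionals compose by mere
    substitution. *)
Record is_expectation (T : Type) (E : (T -> R) -> R) : Prop := IsExpectation {
  exp_lin : forall c f g, E (fun x => c * f x + g x) = c * E f + E g;
  exp_le : forall f g, (forall x, f x <= g x) -> E f <= E g;
  exp_cst : forall c, E (fun=> c) = c }.

Section Theory.
Variables (T : Type) (E : (T -> R) -> R).
Hypothesis hE : is_expectation E.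

Lemma exp_ext f g : f =1 g -> E f = E g.
Proof.
by move=> fg; apply/eqP; rewrite eq_le; apply/andP; split;
  apply: (exp_le hE) => x; rewrite fg.
Qed.

Lemma expZ c f : E (fun x => c * f x) = c * E f.
Proof.
by rewrite -[RHS]addr0 -(exp_cst hE 0) -(exp_lin hE); apply: exp_ext => x; rewrite addr0.
Qed.

Lemma expD f g : E (fun x => f x + g x) = E f + E g.
Proof.
by rewrite -[X in X + _]mul1r -(exp_lin hE); apply: exp_ext => x; rewrite mul1r.
Qed.

Lemma expB f g : E (fun x => f x - g x) = E f - E g.
Proof.
by rewrite addrC -mulN1r -(exp_lin hE); apply: exp_ext => x; rewrite mulN1r addrC.
Qed.

End Theory.

Definition average (T : Type) (s : seq T) (f : T -> R) : R :=
  (\sum_(x <- s) f x) / (size s)%:R.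

Lemma average_map (T T' : Type) (h : T -> T') s f :
  average (map h s) f = average s (f \o h).
Proof. by rewrite /average big_map size_map. Qed.

Lemma average_le_in (T : eqType) (s : seq T) f g :
  {in s, forall x, f x <= g x} -> average s f <= average s g.
Proof.
move=> fg; rewrite /average ler_wpM2r ?invr_ge0 ?ler0n//.
by rewrite big_seq [leRHS]big_seq; apply: ler_sum => x /fg.
Qed.

Lemma average_expectation (T : Type) (s : seq T) :
  (0 < size s)%N -> is_expectation (average s).
Proof.
move=> s0; have s0' : (size s)%:R != 0 :> R by rewrite pnatr_eq0 -lt0n.
split=> [c f g|f g fg|c]; rewrite /average.
- by rewrite big_split /= mulrDl -mulr_sumr mulrA.
- by rewrite ler_wpM2r ?invr_ge0 ?ler0n// ler_sum.
- rewrite big_const_seq count_predT -Monoid.iteropE /=.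
  by rewrite -[iterop _ _ _ _]/(c *+ size s) -[c *+ _]mulr_natr mulfK.
Qed.

Lemma pair_expectation (T U : Type) (E : (T -> R) -> R) (F : T -> (U -> R) -> R) :
  is_expectation E -> (forall x, is_expectation (F x)) ->
  is_expectation (fun f : T * U -> R => E (fun x => F x (fun y => f (x, y)))).
Proof.
move=> hE hF; split=> [c f g|f g fg|c].
- rewrite -(exp_lin hE); apply: (exp_ext hE) => x; exact: (exp_lin (hF x)).
- by apply: (exp_le hE) => x; apply: (exp_le (hF x)).
- by rewrite -[RHS](exp_cst hE); apply: (exp_ext hE) => x; exact: (exp_cst (hF x)).
Qed.

(** * Sums of independent samples: Markov and Chebyshev bounds *)

Section Sampling.
Variables (T : Type) (E : (T -> R) -> R) (X : T -> nat).
Hypothesis hE : is_expectation E.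

(** The law of [acc] plus the sum of [i] independent copies of [X], in the nested form to which a
    sampling loop with an accumulator unfolds. *)
Fixpoint sample_sum (i : nat) (g : nat -> R) (acc : nat) : R :=
  if i is j.+1 then E (fun x => sample_sum j g (acc + X x)) else g acc.

Lemma sample_sum_expectation i acc :
  is_expectation (fun g => sample_sum i g acc).
Proof.
elim: i acc => [|i IH] acc; first by split.
split=> [c f g|f g fg|c] /=.
- by rewrite -(exp_lin hE); apply: (exp_ext hE) => x; exact: (exp_lin (IH _)).
- by apply: (exp_le hE) => x; apply: (exp_le (IH _)).
- by rewrite -[RHS](exp_cst hE); apply: (exp_ext hE) => x; exact: (exp_cst (IH _)).
Qed.

Lemma sample_sum_mean i acc :
  sample_sum i (fun t => t%:R) acc = acc%:R + i%:R * E (fun x => (X x)%:R).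
Proof.
elim: i acc => [|i IH] acc /=; first by rewrite mul0r addr0.
rewrite (exp_ext hE (g := fun x => (X x)%:R + (acc%:R + i%:R * E (fun x => (X x)%:R)))).
  by rewrite (expD hE) (exp_cst hE) -natr1; ring.
by move=> x; rewrite IH natrD; ring.
Qed.

Lemma sample_sum_markov i (U : R) : 0 < U ->
  sample_sum i (fun t => (U <= t%:R)%R%:R) 0 <= i%:R * E (fun x => (X x)%:R) / U.
Proof.
move=> U0; have hS := sample_sum_expectation i 0.
have -> : i%:R * E (fun x => (X x)%:R) / U =
    sample_sum i (fun t => U^-1 * t%:R) 0.
  by rewrite (expZ hS) sample_sum_mean add0r mulrC.
apply: (exp_le hS) => t; case: (leP U t%:R) => Ut.
  by rewrite ler_pdivlMl// mulr1.
by rewrite mulr_ge0// invr_ge0 ltW.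
Qed.

(* Chebyshev for the minorant [Y] of [X], whose partial sum is [y]. *)
Lemma sample_sum_lower_tail (Y : T -> R) (mu v c dev y : R) i acc :
  (forall x, Y x <= (X x)%:R) -> E Y = mu -> E (fun x => Y x ^+ 2) <= v ->
  0 < dev -> y <= acc%:R ->
  sample_sum i (fun t => (t%:R <= c - dev)%R%:R) acc
    <= ((y + i%:R * mu - c) ^+ 2 + i%:R * v) / dev ^+ 2.
Proof.
move=> YX Emu Ev dev0; have dev20 : 0 < dev ^+ 2 by rewrite exprn_gt0.
elim: i acc y => [|i IH] acc y yacc /=.
  rewrite !mul0r !addr0 ler_pdivlMr//;
    case: (leP acc%:R (c - dev)) => h; last by rewrite mul0r sqr_ge0.
  rewrite mul1r.
  suff : dev * dev <= (c - y) * (c - y) by rewrite -!expr2 -[leRHS]sqrrN opprB.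
  by apply: ler_pM; lra.
pose b := y + i%:R * mu - c.
(* The inductive bound, taken at [y + Y x], is a quadratic polynomial in [Y x], so its mean involves
   only the first two moments of [Y]. *)
apply: (@le_trans _ _ (E (fun x => (dev ^+ 2)^-1 *
   (Y x ^+ 2 + (2 * b * Y x + (b ^+ 2 + i%:R * v)))))).
  apply: (exp_le hE) => x.
  apply: le_trans (IH _ (y + Y x) _) _; first by rewrite natrD lerD.
  rewrite [leLHS]mulrC; apply: ler_wpM2l; first by rewrite invr_ge0 ltW.
  by rewrite le_eqVlt; apply/orP; left; apply/eqP; rewrite /b; ring.
rewrite (expZ hE) (expD hE) (exp_lin hE) (exp_cst hE) Emu [leLHS]mulrC.
apply: ler_wpM2r; first by rewrite invr_ge0 ltW.
rewrite -[i.+1%:R]natr1.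
have -> : y + (i%:R + 1) * mu - c = b + mu by rewrite /b; ring.
(* As [v] bounds the second moment rather than the variance, [mu ^+ 2] is left over as slack. *)
have mu20 := sqr_ge0 mu; nra.
Qed.

End Sampling.

(** * Minimum over independent rounds *)

Section Minimum.
Variable F : (nat -> R) -> R.
Hypothesis hF : is_expectation F.

Fixpoint sample_min (k : nat) (g : nat -> R) (best : nat) : R :=
  if k is j.+1 then F (fun S => sample_min j g (minn S best)) else g best.

Lemma sample_min_expectation k best : is_expectation (fun g => sample_min k g best).
Proof.
elim: k best => [|k IH] best; first by split.
split=> [c f g|f g fg|c] /=.
- by rewrite -(exp_lin hF); apply: (exp_ext hF) => x; exact: (exp_lin (IH _)).
- by apply: (exp_le hF) => x; apply: (exp_le (IH _)).
- by rewrite -[RHS](exp_cst hF); apply: (exp_ext hF) => x; exact: (exp_cst (IH _)).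
Qed.

(** The minimum reaches [U] only if the initial value and each of the [k] independent rounds do, so
    the probabilities multiply. *)
Lemma sample_min_upper (U rho : R) k best : 0 <= rho ->
  F (fun t => (U <= t%:R)%R%:R) <= rho ->
  sample_min k (fun t => (U <= t%:R)%R%:R) best <= (U <= best%:R)%R%:R * rho ^+ k.
Proof.
move=> rho0 Frho; elim: k best => [|k IH] best /=; first by rewrite mulr1.
apply: (@le_trans _ _ (F (fun S => (U <= best%:R)%R%:R * rho ^+ k * (U <= S%:R)%R%:R))).
  apply: (exp_le hF) => S; apply: le_trans (IH _) _.
  have -> : (U <= (minn S best)%:R)%R = (U <= best%:R) && (U <= S%:R).
    by rewrite /minn; case: ltnP => Sb; [rewrite andbC|]; apply/idP/andP => [Ux|[]//];
      split=> //; apply: le_trans Ux _; rewrite ler_nat // ltnW.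
  by rewrite -mulnb natrM mulrAC.
rewrite (expZ hF) exprSr mulrA ler_wpM2l// mulr_ge0 ?exprn_ge0//.
Qed.

(** Union bound: the minimum is low only if the initial value or one of the rounds is. *)
Lemma sample_min_lower (L delta : R) k best :
  F (fun t => (t%:R <= L)%R%:R) <= delta ->
  sample_min k (fun t => (t%:R <= L)%R%:R) best <= (best%:R <= L)%R%:R + k%:R * delta.
Proof.
move=> Fdelta; elim: k best => [|k IH] best /=; first by rewrite mul0r addr0.
apply: (@le_trans _ _ (F (fun S => (S%:R <= L)%R%:R +
    ((best%:R <= L)%R%:R + k%:R * delta)))).
  apply: (exp_le hF) => S; apply: le_trans (IH _) _.
  rewrite addrA lerD2r /minn; case: ltnP => _.
    by rewrite lerDl.
  by rewrite lerDr.
by rewrite (expD hF) (exp_cst hF) -natr1; lra.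
Qed.

End Minimum.

End Expectation.

(** * Charging edges to their lower endpoint *)

Section Counting.
Local Open Scope nat_scope.
Variables (n : nat) (A : 'I_n -> seq (option 'I_n)).

Definition degree (v : nat) : nat := size (list_of A v).

(* [a] is the answer to a neighbor query: 0 for an erased entry, [u + 1] for [u]. *)
Definition share (v a : nat) : nat :=
  if a is u.+1 then (degree v <= degree u) + (degree v < degree u) else 2.

Definition entry_total : nat := \sum_(v < n) size (A v).

Lemma list_of_ord (v : 'I_n) : list_of A v = A v.
Proof. by rewrite /list_of valK. Qed.

Lemma degree_ord (v : 'I_n) : degree v = size (A v).
Proof. by rewrite /degree list_of_ord. Qed.

Lemma share_le2 v a : share v a <= 2.
Proof. by case: a => [|u] //=; exact: (leq_add (leq_b1 _) (leq_b1 _)). Qed.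

Lemma all2_leq_sum (S T : Type) (r : S -> T -> bool) (f : S -> nat) (g : T -> nat) s t :
  all2 r s t -> (forall a b, r a b -> f a <= g b) ->
  \sum_(a <- s) f a <= \sum_(b <- t) g b.
Proof.
move=> st fg; elim: s t st => [|a s IH] [|b t] //=; first by rewrite !big_nil.
by case/andP=> ab st; rewrite !big_cons leq_add ?fg ?IH.
Qed.

Lemma all2_sym (S T : Type) (r : S -> T -> bool) s t :
  all2 (fun b a => r a b) t s = all2 r s t.
Proof. by elim: s t => [|a s IH] [|b t] //=; rewrite IH. Qed.

Variables (e : rel 'I_n) (L : 'I_n -> seq 'I_n).
Hypotheses (simple_e : simple_graph e) (adjL : adjacency_lists e L)
  (erasedA : partly_erased L A).

Let size_erased v : size (A v) = size (L v).
Proof. by have := erasedA v; rewrite all2E => /andP[/eqP]. Qed.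

Let sum_adj v (g : 'I_n -> nat) : \sum_(u <- L v) g u = \sum_(u | e v u) g u.
Proof.
have [uL memL] := adjL v; rewrite (big_uniq _ uL).
by apply: eq_bigl => u; rewrite memL.
Qed.

Lemma entry_total_ends : entry_total = \sum_(v < n) \sum_(u | e v u) 1.
Proof. by apply: eq_bigr => v _; rewrite size_erased -sum1_size sum_adj. Qed.

Lemma degree_le v : degree v <= n.
Proof.
rewrite /degree /list_of; case: insubP => //= u _ _; rewrite size_erased.
by have [/card_uniqP <- _] := adjL u; rewrite -[leqRHS]card_ord max_card.
Qed.

Let swap_ends (f : 'I_n -> 'I_n -> nat) :
  \sum_(v < n) \sum_(u | e v u) f v u = \sum_(v < n) \sum_(u | e v u) f u v.
Proof.
rewrite (exchange_big_dep predT) //=; apply: eq_bigr => v _.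
by apply: eq_bigl => u; rewrite simple_e.1.
Qed.

Let sum_ends_split (f g : 'I_n -> 'I_n -> nat) :
  \sum_(v < n) \sum_(u | e v u) (f v u + g v u) =
  \sum_(v < n) \sum_(u | e v u) f v u + \sum_(v < n) \sum_(u | e v u) g v u.
Proof. by rewrite -big_split; apply: eq_bigr => v _; rewrite -big_split. Qed.

(** Handshake lemma: of the two listings of an edge, exactly one has its ends in increasing
    order. *)
Lemma entry_total_edges : entry_total = 2 * edge_count e.
Proof.
rewrite entry_total_ends /edge_count -sum1dep_card.
pose f (v u : 'I_n) : nat := v < u.
transitivity (\sum_(v < n) \sum_(u | e v u) (f v u + f u v)).
  apply: eq_bigr => v _; apply: eq_bigr => u evu; rewrite /f.
  case: ltngtP => // /val_inj vu; by move: evu; rewrite vu simple_e.2.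
rewrite sum_ends_split -[X in _ + X]swap_ends addnn mul2n; congr _.*2.
rewrite pair_big_dep /= /f [RHS]big_mkcond [LHS]big_mkcond /=; apply: eq_bigr => -[v u] _ /=.
by case: ltnP; case: (e v u).
Qed.

(** Exchanging the two ends in the strict term leaves, for each ordered pair of adjacent vertices,
    the value of [c] at the end of lower degree (the first end in a tie), exactly once. *)
Let share_ends (c : 'I_n -> nat) :
  \sum_(v < n) \sum_(u | e v u) c v * share v u.+1 =
  \sum_(v < n) \sum_(u | e v u)
    (c v * (size (A v) <= size (A u)) + c u * (size (A u) < size (A v))).
Proof.
rewrite /share.
under eq_bigr => v _ do under eq_bigr => u _ do rewrite !degree_ord mulnDr.
by rewrite !sum_ends_split; congr (_ + _); rewrite swap_ends.
Qed.

(** Without erasure the shares sum to the number of ordered adjacent pairs, by [share_ends] with [c]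
    constantly 1; an erased entry has share 2, hence adds at most 2. *)
Lemma share_sum_le :
  \sum_(v < n) \sum_(a <- A v) share v (word_of_entry a)
    <= entry_total + 2 * erased_count A.
Proof.
have -> : entry_total = \sum_(v < n) \sum_(u | e v u) 1 * share v u.+1.
  rewrite (share_ends (fun=> 1)) entry_total_ends; apply: eq_bigr => v _.
  by apply: eq_bigr => u _; case: leqP.
rewrite /erased_count big_distrr -big_split; apply: leq_sum => v _ /=.
rewrite -sum_adj -sum1_count big_distrr /= [X in _ <= _ + X]big_mkcond /=.
elim: (A v) (L v) (erasedA v) => [|a s IH] [|u t] //=; first by rewrite !big_nil.
case/andP=> ab st; rewrite !big_cons addnACA leq_add ?IH//.
case: a ab => [w|_] /=; last by rewrite (leq_trans (share_le2 v 0)) ?leq_addl.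
by case/eqP=> <-; rewrite mul1n leq_addr.
Qed.

(** Caps the overestimate at a factor 2, the better bound once [alpha] exceeds 1/2. *)
Lemma share_sum_le2 :
  \sum_(v < n) \sum_(a <- A v) share v (word_of_entry a) <= 2 * entry_total.
Proof.
rewrite big_distrr leq_sum //= => v _.
rewrite -sum1_size big_distrr leq_sum //= => a _; exact: share_le2.
Qed.

(* Only edges inside the heavy set are lost: the lower endpoint of any other
   edge is light. *)
Lemma light_share_sum_ge (t : nat) :
  entry_total <= \sum_(v < n) \sum_(a <- A v)
      (size (A v) <= t) * share v (word_of_entry a)
    + #|[set v : 'I_n | t < size (A v)]| ^ 2.
Proof.
set light := fun v : 'I_n => (size (A v) <= t : nat).
set H := [set v : 'I_n | _].
apply: (@leq_trans (\sum_(v < n) \sum_(u | e v u) light v * share v u.+1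
  + \sum_(v < n) \sum_(u < n) (v \in H) * (u \in H))).
  rewrite share_ends entry_total_ends -big_split leq_sum //= => v _.
  rewrite [X in _ <= _ + X](bigID (e v)) addnA (leq_trans _ (leq_addr _ _)) //=.
  rewrite -big_split leq_sum //= => u _; rewrite !inE /light.
  by case: (leqP (size (A v)) (size (A u))); case: (leqP (size (A v)) t);
    case: (leqP (size (A u)) t) => //=; lia.
rewrite leq_add //.
  apply: leq_sum => v _; rewrite -sum_adj.
  (* Erasing an entry can only raise its share, since 2 is the largest one. *)
  apply: (all2_leq_sum (r := fun u a => (a == None) || (a == Some u))).
    by have := erasedA v; rewrite -all2_sym.
  move=> u [w|_] /=; first by case/eqP=> ->.
  by rewrite leq_mul2l (share_le2 v u.+1) orbT.
under eq_bigr => v _ do rewrite -big_distrr.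
rewrite -big_distrl /= expnS expn1.
suff -> : \sum_(v < n) (v \in H) = #|H| by [].
by rewrite -sum1_card [RHS]big_mkcond; apply: eq_bigr => v _; case: (v \in H).
Qed.

Lemma heavy_card (t : nat) :
  #|[set v : 'I_n | t < size (A v)]| * t.+1 <= entry_total.
Proof.
rewrite -sum_nat_const /entry_total [leqRHS](bigID (mem [set v : 'I_n | t < size (A v)])) /=.
by apply: leq_trans (leq_addr _ _); apply: leq_sum => v; rewrite inE.
Qed.

End Counting.

(** * The program and its execution *)

(* Cells: 0 [n]; 1 samples per round; 2 the constant 1; 3 and 4 [r] and [r ^ 2]
   in the search for the rounded square root of [n]; 5 rounds left; 6 least sum
   so far; 7 current sum; 8 samples left; 9 [v]; 10 [deg v]; 11 entry of the
   list of [v]; 12 [deg u]; 13 the constant 0. *)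
Definition sample_code : program :=
  [:: Bin Defs.Sub 8 8 2; Rand 9 0; DegQuery 10 9; NbrQuery 11 9;
      If 11 2 [:: Bin Add 7 7 10; Bin Add 7 7 10]
        [:: Bin Defs.Sub 11 11 2; DegQuery 12 11;
            If 12 10 [::] [:: Bin Add 7 7 10];
            If 10 12 [:: Bin Add 7 7 10] [::]]].

(** Cell 13 always holds 0: a guard [While 13 x] tests that cell [x] is nonzero, and
    [Bin Add x y 13] copies cell [y] to cell [x]. *)
Definition round_code : program :=
  [:: Bin Defs.Sub 5 5 2; Const 7 0; Bin Add 8 1 13; While 13 8 sample_code;
      If 7 6 [:: Bin Add 6 7 13] [::]].

(** A linear search for the root takes about [3 * sqrt n] steps, which the time bound can afford. *)
Definition sqrt_code : program := [:: Bin Add 3 3 2; Bin Mul 4 3 3].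

(* [K] rounds of [c * r] samples, where [r] is the rounded up square root of [n]. *)
Definition estimator (c K : nat) : program :=
  [:: Const 2 1; While 4 0 sqrt_code; Const 1 c; Bin Mul 1 1 3; Const 5 K;
      Bin Mul 6 0 1; While 13 5 round_code; Bin Add 0 6 13].

Section Semantics.
Variables (R : realType) (W n : nat) (A : 'I_n -> seq (option 'I_n)).
Variable (E : config -> bool).

(** Halting is required on every branch, so that a claim at time [T] persists at later times;
    branches of different lengths can then be padded to a common time. *)
Definition attains (c : config) (T : nat) (pr : R) : Prop :=
  surely W A halted T c /\ pr <= prob R W A E T c.

Definition update (M : nat -> nat) (x v : nat) : nat -> nat :=
  fun y => if y == x then v else M y.

Lemma write_small M x v : (v < W)%N -> write W M x v = update M x v.
Proof. by move=> vW; rewrite /write modn_small. Qed.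

Lemma surely_sub (P Q : config -> bool) T c :
  (forall c, P c -> Q c) -> surely W A P T c -> surely W A Q T c.
Proof. by move=> PQ; elim: T c => [|T IH] c /=; [exact: PQ|apply: sub_all]. Qed.

Lemma surely_and (P Q : config -> bool) T c :
  surely W A P T c -> surely W A Q T c -> surely W A (fun c => P c && Q c) T c.
Proof.
elim: T c => [|T IH] c /=; first by move=> -> ->.
elim: (step W A c) => //= d s IHs /andP[Pd Ps] /andP[Qd Qs].
by rewrite IH // IHs.
Qed.

(** Each step makes at most one query, so a time bound is also a query bound. *)
Lemma surely_queries T c :
  surely W A (fun c' => (queries c' <= queries c + T)%N) T c.
Proof.
elim: T c => [|T IH] c /=; first by rewrite addn0.
have : all (fun c' => (queries c' <= (queries c).+1)%N) (step W A c).
  by case: c => -[|[x k|o x y z|x y|x y|x y|x y|x y|x y p1 p2|x y b] p] M q /=;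
    rewrite ?leqnSn ?leqnn ?all_map //=; apply/allP => r _ /=.
apply: sub_all => d dq; apply: surely_sub (IH d) => c' /leq_trans; apply.
by rewrite addnS -addSn leq_add2r.
Qed.

Lemma halted_step T c : surely W A halted T c ->
  surely W A halted T.+1 c /\ prob R W A E T.+1 c = prob R W A E T c.
Proof.
elim: T c => [|T IH] c.
  case: c => -[|i p] M q //= _; split => //; by rewrite big_seq1 divr1.
rewrite /= => hc.
suff [h1 h2] : all (surely W A halted T.+1) (step W A c) /\
    \sum_(d <- step W A c) prob R W A E T.+1 d = \sum_(d <- step W A c) prob R W A E T d.
  by split=> //; congr (_ / _).
elim: (step W A c) hc => [|d s IHs]; first by rewrite !big_nil.
case/andP => /IH[hd Ed] /IHs[hs Es]; rewrite !big_cons Es Ed.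
by split=> //; apply/andP.
Qed.

Lemma attains_later c T T' pr pr' : attains c T pr -> (T <= T')%N -> pr' <= pr ->
  attains c T' pr'.
Proof.
move=> aT TT' le_pr; rewrite -(subnK TT'); elim: (T' - T)%N => [|j [IHs IHp]].
  by case: aT => ? /(le_trans le_pr).
have [hs hp] := halted_step IHs.
by split; rewrite addSn // hp.
Qed.

Lemma attains_average (T : nat) c (l : seq nat) (d : nat -> config) f :
  step W A c = [seq d r | r <- l] ->
  {in l, forall r, attains (d r) T (f r)} -> attains c T.+1 (average l f).
Proof.
move=> stepc ad; split=> /=.
  by rewrite stepc all_map; apply/allP => r /ad[].
rewrite stepc -[leRHS]/(average _ (prob R W A E T)) average_map.
by apply: average_le_in => r /ad[].
Qed.

Lemma attains_step T c d pr : step W A c = [:: d] -> attains d T pr -> attains c T.+1 pr.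
Proof.
move=> stepc [ds dp]; split; rewrite /= stepc /= ?ds // big_seq1 divr1 //.
Qed.

(** * Backward rules for single instructions *)

Lemma attains_const x k p M q T pr : (k < W)%N ->
  attains (Config p (update M x k) q) T pr -> attains (Config (Const x k :: p) M q) T.+1 pr.
Proof. by move=> kW; apply: attains_step; rewrite /= write_small. Qed.

Lemma attains_bin v o x y z p M q T pr : eval_binop o (M y) (M z) = v -> (v < W)%N ->
  attains (Config p (update M x v) q) T pr ->
  attains (Config (Bin o x y z :: p) M q) T.+1 pr.
Proof. by move=> <- vW; apply: attains_step; rewrite /= write_small. Qed.

Lemma attains_deg v x y p M q T pr : degree A (M y) = v -> (v < W)%N ->
  attains (Config p (update M x v) q.+1) T pr ->
  attains (Config (DegQuery x y :: p) M q) T.+1 pr.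
Proof. by move=> <- vW; apply: attains_step; rewrite /= write_small. Qed.

Lemma attains_if x y p1 p2 p M q T pr :
  attains (Config ((if (M x < M y)%N then p1 else p2) ++ p) M q) T pr ->
  attains (Config (If x y p1 p2 :: p) M q) T.+1 pr.
Proof. exact: attains_step. Qed.

Lemma attains_while x y b p M q T pr :
  attains (Config (if (M x < M y)%N then b ++ While x y b :: p else p) M q) T pr ->
  attains (Config (While x y b :: p) M q) T.+1 pr.
Proof. exact: attains_step. Qed.

Lemma attains_rand x y k p M q T f : M y = k -> (0 < k <= W)%N ->
  (forall r, (r < k)%N -> attains (Config p (update M x r) q) T (f r)) ->
  attains (Config (Rand x y :: p) M q) T.+1 (average (iota 0 k) f).
Proof.
move=> Myk /andP[k0 kW] ad.
apply: (attains_average (d := fun r => Config p (write W M x r) q)).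
  by rewrite /= Myk; case: k k0 {Myk kW ad}.
move=> r; rewrite mem_iota add0n => /andP[_ rk].
by rewrite write_small ?(leq_trans rk) //; apply: ad.
Qed.

Lemma attains_nbr x y p M q T f : (n < W)%N ->
  (forall r, (r <= n)%N -> attains (Config p (update M x r) q.+1) T (f r)) ->
  attains (Config (NbrQuery x y :: p) M q) T.+1 (average (nbr_answers A (M y)) f).
Proof.
move=> nW ad.
apply: (attains_average (d := fun r => Config p (write W M x r) q.+1)) => // r rl.
have rn : (r <= n)%N.
  move: rl; rewrite /nbr_answers; case: (list_of A (M y)) => [|a l].
    by rewrite inE => /eqP->.
  by case/mapP => -[u|] _ -> //=.
by rewrite write_small; [exact: ad|exact: leq_ltn_trans nW].
Qed.

(** * Execution of the loops of the estimator *)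

Local Open Scope nat_scope.

Definition gain (x : nat * nat) : nat := (degree A x.1 * share A x.1 x.2)%N.

Definition draw (f : nat * nat -> R) : R :=
  average (iota 0 n) (fun v => average (nbr_answers A v) (fun a => f (v, a))).

Hypotheses (n_gt0 : (0 < n)%N) (degree_le : forall v, (degree A v <= n)%N).

Definition round_state M s k b :=
  [/\ [/\ M 0 = n, M 1 = s & M 2 = 1], M 13 = 0, M 5 = k & M 6 = b]%N.

(** The longest branch, an intact entry with [deg v < deg u], takes 11 steps, and the others are
    padded. A gain is at most [2 * n], so the sum never wraps around modulo [W]. *)
Lemma attains_sample_code M q s k b acc i p T f :
  round_state M s k b -> M 7 = acc -> M 8 = i.+1 ->
  (i < W)%N -> (n < W)%N -> (acc + 2 * n < W)%N ->
  (forall x M' q', round_state M' s k b -> M' 7 = (acc + gain x)%N -> M' 8 = i ->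
    attains (Config p M' q') T (f x)) ->
  attains (Config (sample_code ++ p) M q) (T + 11) (draw f).
Proof.
move=> [[M0 M1 M2] M13 M5 M6] M7 M8 iW nW accW cont.
rewrite addnC; apply: (attains_bin (v := i)) => //; first by rewrite /= M8 M2 subn1.
apply: attains_rand; rewrite /update //= ?M0 //; first by rewrite n_gt0 ltnW.
move=> v vn; have dW v' : (degree A v' < W)%N by apply: leq_ltn_trans nW.
apply: (attains_deg (v := degree A v)) => //.
apply: attains_nbr => // a an.
rewrite /update /=.
have accW' : (acc + degree A v + degree A v < W)%N.
  by apply: leq_ltn_trans accW; rewrite -addnA addnn -mul2n leq_add2l leq_mul2l degree_le orbT.
have accW1 : (acc + degree A v < W)%N by apply: leq_ltn_trans accW'; rewrite leq_addr.
apply: attains_if => /=; rewrite M2; case: a an => [|u] un /=.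
  apply: (attains_bin (v := acc + degree A v)%N) => //=; first by rewrite M7.
  apply: (attains_bin (v := acc + degree A v + degree A v)%N) => //=.
  apply: attains_later (cont (v, 0%N) _ _ _ _ _) _ (lexx _) => //=; last by lia.
  by rewrite /update /= /gain /=; lia.
apply: (attains_bin (v := u)) => //=; [by rewrite M2 subn1|exact: ltn_trans nW|].
apply: (attains_deg (v := degree A u)) => //=.
apply: attains_if => /=; rewrite /update /=.
have done_step M' q' T' : round_state M' s k b -> M' 7 = (acc + gain (v, u.+1))%N ->
    M' 8 = i -> (T <= T')%N -> attains (Config p M' q') T' (f (v, u.+1)).
  move=> st' M'7 M'8 TT'.
  by apply: attains_later (cont (v, u.+1) _ _ _ _ _) TT' (lexx _).
case: (ltngtP (degree A u) (degree A v)) => uv /=.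
- apply: attains_if => /=; rewrite ltnNge (ltnW uv) /=.
  by apply: done_step => //=; rewrite ?addn0 /gain /=; lia.
- apply: (attains_bin (v := acc + degree A v)%N) => //=; first by rewrite M7.
  apply: attains_if => /=; rewrite /update /= uv /=.
  apply: (attains_bin (v := acc + degree A v + degree A v)%N) => //=.
  by apply: done_step => //=; rewrite /update ?/gain /= ?uv ?(ltnW uv); lia.
- apply: (attains_bin (v := acc + degree A v)%N) => //=; first by rewrite M7.
  apply: attains_if => /=; rewrite /update /= uv ltnn /=.
  by apply: done_step => //=; rewrite /update ?/gain /= ?uv ?leqnn ?ltnn; lia.
Qed.

Lemma attains_samples M q s k b acc i p T g :
  round_state M s k b -> M 7 = acc -> M 8 = i ->
  (i <= W)%N -> (n < W)%N -> (acc + 2 * n * i < W)%N ->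
  (forall t M' q', round_state M' s k b -> M' 7 = t -> (t < W)%N ->
    attains (Config p M' q') T (g t)) ->
  attains (Config (While 13 8 sample_code :: p) M q) (T + 12 * i + 1)
    (sample_sum draw gain i g acc).
Proof.
move=> st M7 M8 iW nW; elim: i M q acc st M7 M8 iW => [|i IH] M q acc st M7 M8 iW accW cont.
  rewrite addn1; apply: attains_while; rewrite M8; have [_ -> _ _] := st.
  by rewrite muln0 addn0; apply: cont => //; rewrite muln0 addn0 in accW.
rewrite addn1; apply: attains_while; rewrite M8; have [_ -> _ _] := st.
rewrite ltn0Sn; have -> : (T + 12 * i.+1 = (T + 12 * i + 1) + 11)%N by lia.
apply: (attains_sample_code _ st M7 M8) => //.
  by apply: leq_ltn_trans accW; rewrite leq_add2l leq_pmulr.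
move=> x M' q' st' M'7 M'8; apply: IH => //; first exact: ltnW.
apply: leq_ltn_trans accW; rewrite -addnA leq_add2l mulnS leq_add2r /gain mulnC.
by rewrite leq_mul // share_le2.
Qed.

(** A round costs one guard, three assignments, [12 * s + 1] steps of sampling and at most two steps
    to update the minimum. *)
Lemma attains_rounds M q s k b p T g :
  round_state M s k b -> (k < W)%N -> (s < W)%N -> (n < W)%N -> (2 * n * s < W)%N ->
  (forall t M' q', M' 1 = s -> M' 6 = t -> M' 13 = 0 -> (t < W)%N ->
    attains (Config p M' q') T (g t)) ->
  (b < W)%N ->
  attains (Config (While 13 5 round_code :: p) M q) (T + (12 * s + 7) * k + 1)
    (sample_min (fun g => sample_sum draw gain s g 0) k g b).
Proof.
move=> st kW sW nW nsW cont; elim: k M q b st kW => [|k IH] M q b st kW bW;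
  have [[M0 M1 M2] M13 M5 M6] := st; rewrite addn1; apply: attains_while; rewrite M13 M5.
  by rewrite muln0 addn0; apply: cont.
rewrite ltn0Sn; have -> : (T + (12 * s + 7) * k.+1 =
  ((T + (12 * s + 7) * k + 1).+2 + 12 * s + 1).+3)%N by lia.
apply: (attains_bin (v := k)) => //=; [by rewrite M5 M2 subn1|exact: ltnW|].
apply: attains_const; first by apply: leq_ltn_trans nW.
apply: (attains_bin (v := s)) => //=; first by rewrite /update /= M1 M13 addn0.
apply: (@attains_samples _ _ s k b) => //; first exact: ltnW.
move=> t M' q' [[M'0 M'1 M'2] M'13 M'5 M'6] M'7 tW.
apply: attains_if; rewrite M'6 M'7 /minn; case: ltnP => _.
  apply: (attains_bin (v := t)) => //=; first by rewrite M'7 M'13 addn0.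
  by apply: IH => //; exact: ltnW.
by apply: attains_later (IH _ _ b _ _ _) (leqnSn _) (lexx _) => //; exact: ltnW.
Qed.

Lemma attains_sqrt M q r0 r p T pr :
  M 0 = n -> M 2 = 1 -> M 3 = r -> M 4 = r * r -> r <= r0 ->
  n <= r0 * r0 -> (forall r', r' < r0 -> r' * r' < n) -> r0 * r0 < W ->
  (forall M' q', M' 0 = n -> M' 2 = 1 -> M' 3 = r0 ->
     (forall a, 4 < a -> M' a = M a) -> attains (Config p M' q') T pr) ->
  attains (Config (While 4 0 sqrt_code :: p) M q) (T + 3 * (r0 - r) + 1) pr.
Proof.
move=> M0 M2 M3 M4 rr0 nr0 ltr0 r0W.
move rj : (r0 - r) => j.
elim: j r rj rr0 M q M0 M2 M3 M4 => [|j IH] r rj rr0 M q M0 M2 M3 M4 cont.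
  have rE : r = r0 by apply/eqP; rewrite eqn_leq rr0 -subn_eq0 rj.
  rewrite addn1; apply: attains_while; rewrite M0 M4 rE ltnNge nr0 muln0 addn0.
  by apply: cont => //; rewrite -rE.
have r_lt : r < r0 by rewrite -subn_gt0 rj.
rewrite addn1; apply: attains_while; rewrite M0 M4 ltr0 //.
have -> : T + 3 * j.+1 = (T + 3 * j + 1).+2 by lia.
have sqW : r.+1 * r.+1 < W by apply: leq_ltn_trans r0W; rewrite leq_mul.
apply: (attains_bin (v := r.+1)) => /=; first by rewrite M2 M3 addn1.
  by apply: leq_ltn_trans sqW; rewrite leq_pmulr.
apply: (attains_bin (v := r.+1 * r.+1)) => //=.
apply: (IH r.+1) => //; first by rewrite subnS rj.
move=> M' q' M'0 M'2 M'3 M'z; apply: cont => // a a4; rewrite M'z // /update.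
by case: a a4 => [|[|[|[|[|a]]]]].
Qed.

Lemma attains_estimator c K r0 g M q :
  M 0 = n -> (forall a, 0 < a -> M a = 0) ->
  n <= r0 * r0 -> (forall r', r' < r0 -> r' * r' < n) -> r0 * r0 < W ->
  n < W -> 1 < W -> c < W -> K < W -> 2 * n * (c * r0) < W ->
  (forall t M' q', M' 0 = t -> M' 1 = c * r0 -> (g t <= (E (Config [::] M' q'))%:R)%R) ->
  attains (Config (estimator c K) M q) (3 * r0 + (12 * (c * r0) + 7) * K + 8)
    (sample_min (fun g => sample_sum draw gain (c * r0) g 0) K g (n * (c * r0))).
Proof.
move=> M0 Mz nr0 ltr0 r0W nW W1 cW KW nsW gE.
have sW : c * r0 < W by apply: leq_ltn_trans nsW; rewrite leq_pmull // muln_gt0.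
have nsW' : n * (c * r0) < W by apply: leq_ltn_trans nsW; rewrite -mulnA leq_pmull.
have -> : 3 * r0 + (12 * (c * r0) + 7) * K + 8 =
   (((1 + (12 * (c * r0) + 7) * K + 1).+4) + 3 * (r0 - 0) + 1).+1 by lia.
apply: attains_const => //.
apply: (@attains_sqrt _ _ r0 0) => //; rewrite ?/update /= ?Mz //.
move=> M' q' M'0 M'2 M'3 M'z.
apply: attains_const => //.
apply: (attains_bin (v := c * r0)) => //=; first by rewrite /update /= M'3.
apply: attains_const => //.
apply: (attains_bin (v := n * (c * r0))) => //=; first by rewrite /update /= M'0.
apply: attains_rounds => //.
  by split; [split| | |]; rewrite /update //= M'z // /update /= Mz.
move=> t M'' q'' M''1 M''6 M''13 tW.
apply: (attains_bin (v := t)) => //=; first by rewrite M''6 M''13 addn0.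
by split=> //=; apply: gE; rewrite /update.
Qed.

End Semantics.

(** * Analysis of the estimator *)

Section Analysis.
Variables (R : realType) (n : nat) (A : 'I_n -> seq (option 'I_n)).
Hypothesis n_gt0 : (0 < n)%N.

Local Notation d := (avg_degree R A).
Local Notation draw := (draw (R := R) A).
Local Notation gain := (gain A).

Lemma avg_degreeE : d = (entry_total A)%:R / n%:R.
Proof. by rewrite /avg_degree /half_length mulrCA divff ?mulr1 // pnatr_eq0. Qed.

Lemma draw_expectation : is_expectation draw.
Proof.
apply: (@pair_expectation _ _ _ (average (iota 0 n))
  (fun v => average (nbr_answers A v))) => [|v]; apply: average_expectation; first by rewrite size_iota.
by rewrite /nbr_answers; case: (list_of A v).
Qed.

(* The factor [degree v] cancels the uniform choice among its entries; it also
   makes the answer 0 given for an empty list harmless. *)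
Lemma draw_degree (h : nat -> nat -> R) :
  draw (fun x => (degree A x.1)%:R * h x.1 x.2) =
  (\sum_(v < n) \sum_(a <- A v) h v (word_of_entry a)) / n%:R.
Proof.
rewrite /draw /average size_iota; congr (_ / _).
rewrite -[n in iota 0 n]subn0 big_mkord; apply: eq_bigr => v _ /=.
rewrite /nbr_answers /degree list_of_ord.
case: (A v) => [|a l]; first by rewrite big_seq1 big_nil mul0r divr1.
rewrite -mulr_sumr size_map mulrAC divff ?pnatr_eq0 // mul1r big_map //.
Qed.

Lemma draw_gain (c : nat -> nat) :
  draw (fun x => (c (degree A x.1) * gain x)%:R) =
  (\sum_(v < n) \sum_(a <- A v) c (size (A v)) * share A v (word_of_entry a))%N%:R / n%:R.
Proof.
have /= := draw_degree (fun v a => (c (degree A v) * share A v a)%:R).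
rewrite /gain => E1.
rewrite (exp_ext draw_expectation (g := fun x => (degree A x.1)%:R *
   (c (degree A x.1) * share A x.1 x.2)%:R)) ?E1.
  congr (_ / _); rewrite natr_sum; apply: eq_bigr => v _.
  by rewrite natr_sum; apply: eq_bigr => a _; rewrite degree_ord.
by move=> x; rewrite !natrM; ring.
Qed.

Variables (alpha eps : R).
Hypotheses (alpha01 : 0 <= alpha <= 1) (eps0 : 0 < eps) (eps_lt : eps < 1 / 2).
Hypotheses (erasedA : erased_graph alpha A) (d_ge1 : 1 <= d).

Let d_gt0 : 0 < d. Proof. exact: lt_le_trans d_ge1. Qed.
Let n0 : 0 < n%:R :> R. Proof. by rewrite ltr0n. Qed.
Let entryE : (entry_total A)%:R = d * n%:R.
Proof. by rewrite avg_degreeE divfK // gt_eqF. Qed.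

Lemma erased_degree_le v : (degree A v <= n)%N.
Proof. by have [e [L [_ adjL erasedL _]]] := erasedA; exact: degree_le adjL erasedL v. Qed.

Lemma avg_degree_le : d <= n%:R.
Proof.
rewrite avg_degreeE ler_pdivrMr // -natrM ler_nat -[X in (X * n)%N]card_ord -sum_nat_const.
by apply: leq_sum => v _; rewrite -degree_ord erased_degree_le.
Qed.

Local Notation B := (1 + 2 * Num.min alpha (1 / 2)).

(** The lists have total length [2 * m], so at most a fraction [alpha] of the entries is erased and
    [share_sum_le] gives the factor [1 + 2 * alpha]; [share_sum_le2] gives the factor 2. *)
Lemma draw_gain_le : draw (fun x => (gain x)%:R) <= B * d.
Proof.
have := draw_gain (fun=> 1%N).
under [draw _](exp_ext draw_expectation) => x do rewrite mul1n.
under eq_bigr => v _ do under eq_bigr => a _ do rewrite mul1n.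
move=> ->; rewrite ler_pdivrMr // -mulrA -entryE.
have [e [L [simple_e adjL erasedL erased_le]]] := erasedA.
have := share_sum_le simple_e adjL erasedL; have := share_sum_le2 A.
set S := (\sum_(v < n) _)%N; rewrite -!(ler_nat R) natrD !natrM => S2 S1.
have := entry_total_edges simple_e adjL erasedL => /(congr1 (fun k : nat => k%:R : R)).
rewrite natrM => entryED; rewrite entryED in S1 S2 *.
rewrite /Num.min; case: ifP => _; lra.
Qed.

(** With [D = d * n] the total length and [h] heavy vertices, [h * (t + 1) <= D]; hence the loss
    [h ^ 2] is at most [D ^ 2 / (t + 1) ^ 2 <= (eps / 2) * D]. *)
Lemma draw_light_ge (t : nat) : n%:R <= (eps / 2) * t.+1%:R ^+ 2 / d ->
  (1 - eps / 2) * d <= draw (fun x => ((degree A x.1 <= t) * gain x)%N%:R).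
Proof.
move=> nt; rewrite (draw_gain (fun k => (k <= t)%N)) ler_pdivlMr // -mulrA -entryE.
have [e [L [simple_e adjL erasedL _]]] := erasedA.
have := light_share_sum_ge simple_e adjL erasedL t; have := heavy_card A t.
set h := #|_|; set S := (\sum_(v < n) _)%N.
rewrite -!(ler_nat R) natrD natrM natrX => ht hS.
suff : h%:R ^+ 2 <= eps / 2 * (entry_total A)%:R :> R by lra.
have t0 : 0 < t.+1%:R ^+ 2 :> R by rewrite exprn_gt0 // ltr0n.
rewrite -(ler_pM2r t0) -exprMn.
apply: (@le_trans _ _ ((entry_total A)%:R ^+ 2)).
  by rewrite ler_sqr ?nnegrE ?mulr_ge0.
have D0 : 0 <= (entry_total A)%:R :> R by [].
rewrite expr2 mulrAC ler_wpM2r // entryE mulrC -ler_pdivlMr //.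
Qed.

Variables (r0 e s : nat).
Hypotheses (r0_sq : (n <= r0 * r0)%N) (e_ge : 1 / eps <= e%:R)
  (sE : s%:R = (8 * e%:R) ^+ 4 * r0%:R :> R).

Let r0_gt0 : (0 < r0)%N.
Proof. by case: r0 r0_sq => //; rewrite leqNgt n_gt0. Qed.
Let e_eps : 1 <= e%:R * eps. Proof. by rewrite -ler_pdivrMr. Qed.
Let e_gt0 : 0 < e%:R :> R. Proof. by apply: lt_le_trans e_ge; rewrite divr_gt0. Qed.

Let s_gt0 : 0 < s%:R :> R.
Proof. by rewrite sE mulr_gt0 ?ltr0n // exprn_gt0 // mulr_gt0. Qed.

(** Markov gives [B / (B + eps)], which is at most [1 / (1 + eps / 2)] because [B <= 2]. *)
Lemma round_upper :
  sample_sum draw gain s (fun t => (s%:R * ((B + eps) * d) <= t%:R)%R%:R) 0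
    <= (1 + eps / 2)^-1.
Proof.
have eps2 : 0 < 1 + eps / 2 by rewrite addr_gt0 // divr_gt0.
have B_ge1 : 1 <= B by rewrite lerDl mulr_ge0 // le_min; case/andP: alpha01 => -> _ /=; lra.
have B_le2 : B <= 2 by have : Num.min alpha (1 / 2) <= 1 / 2 by [rewrite ge_min lexx orbT]; lra.
have U0 : 0 < (B + eps) * d by rewrite mulr_gt0 // addr_gt0 // (lt_le_trans ltr01).
apply: le_trans (sample_sum_markov _ draw_expectation _ _) _.
  by rewrite mulr_gt0.
rewrite -mulf_div divff ?gt_eqF // mul1r ler_pdivrMr // ler_pdivlMl //.
apply: le_trans (_ : (1 + eps / 2) * (B * d) <= _); first by rewrite ler_wpM2l ?draw_gain_le // ltW.
rewrite mulrA ler_wpM2r ?(ltW d_gt0) //; move: (B) B_le2 => b b2; have := eps0; nra.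
Qed.

Lemma round_lower :
  sample_sum draw gain s (fun t => (t%:R <= s%:R * ((1 - eps) * d))%R%:R) 0
    <= 1 / (128 * e%:R).
Proof.
have hD := draw_expectation.
move: (eps0) (eps_lt) (d_ge1) (d_gt0) => eps_gt0 eps_lt2 d1 d0.
(* This cutoff makes [(eps / 2) * tau ^ 2] equal to [2 * r0 ^ 2 * d ^ 2 / eps], which is at least
   [n * d] since [n <= r0 ^ 2] and [1 <= d]. *)
pose tau := 2 * r0%:R * d / eps.
have r0R : 0 < r0%:R :> R by rewrite ltr0n.
have tau0 : 0 <= tau by rewrite !mulr_ge0 // ?invr_ge0 ltW.
have /andP[t_le t_gt] := truncn_itv tau0.
set t := Num.truncn tau in t_le t_gt.
pose Y (x : nat * nat) : R := ((degree A x.1 <= t) * gain x)%N%:R.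
have EY : (1 - eps / 2) * d <= draw Y.
  apply: draw_light_ge; rewrite ler_pdivlMr //.
  apply: (@le_trans _ _ (eps / 2 * tau ^+ 2)); last first.
    by rewrite ler_wpM2l ?divr_ge0 ?(ltW eps0) // ler_sqr ?nnegrE // ltW.
  have -> : eps / 2 * tau ^+ 2 = (r0%:R * r0%:R) * d * (2 / eps * d).
    by rewrite /tau; field; rewrite gt_eqF.
  have : n%:R <= r0%:R * r0%:R :> R by rewrite -natrM ler_nat.
  move=> nr; apply: (@le_trans _ _ (r0%:R * r0%:R * d)); first by rewrite ler_wpM2r // ltW.
  rewrite ler_peMr ?mulr_ge0 ?(ltW r0R) ?(ltW d_gt0) // mulrAC ler_pdivlMr //; nra.
have Y_gain x : Y x <= (gain x)%:R.
  by rewrite /Y ler_nat -[leqRHS]mul1n leq_mul // leq_b1.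
have EY2 : draw Y <= 2 * d.
  apply: (@le_trans _ _ (draw (fun x => (gain x)%:R))); first exact: (exp_le hD).
  apply: le_trans draw_gain_le _; rewrite ler_wpM2r ?(ltW d_gt0) //.
  have : Num.min alpha (1 / 2) <= 1 / 2 by rewrite ge_min lexx orbT.
  lra.
have EYsq : draw (fun x => Y x ^+ 2) <= 2 * tau * (2 * d).
  apply: (@le_trans _ _ (draw (fun x => 2 * tau * Y x))).
    (* A gain is at most twice the degree, so [Y x <= 2 * t <= 2 * tau]. *)
    apply: (exp_le hD) => x; rewrite expr2 ler_wpM2r ?ler0n //.
    apply: (@le_trans _ _ (2 * t%:R)); last by rewrite ler_wpM2l.
    rewrite -natrM ler_nat /gain; case: (leqP (degree A x.1) t) => // dt; rewrite mul1n mulnC.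
    by rewrite leq_mul // share_le2.
  by rewrite (expZ hD) ler_wpM2l // mulr_ge0.
(* Half of the allowed error [eps * d] went into dropping heavy vertices; the other half is left for
   the deviation. *)
pose dev := s%:R * (eps / 2 * d).
have dev0 : 0 < dev by rewrite mulr_gt0 // mulr_gt0 // divr_gt0.
have dev_le : s%:R * ((1 - eps) * d) <= s%:R * draw Y - dev.
  by rewrite /dev -mulrBr ler_wpM2l ?(ltW s_gt0) //; lra.
apply: (@le_trans _ _ (sample_sum draw gain s
    (fun t => (t%:R <= s%:R * draw Y - dev)%R%:R) 0)).
  apply: (exp_le (sample_sum_expectation gain hD s 0)) => k.
  rewrite ler_nat; case: (leP k%:R (s%:R * ((1 - eps) * d))) => // /le_trans -> //.
apply: le_trans (@sample_sum_lower_tail R _ draw gain hD Y (draw Y) _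
  (s%:R * draw Y) dev 0 s 0 Y_gain erefl EYsq dev0 (lexx _)) _.
rewrite add0r subrr expr0n /= add0r.
rewrite ler_pdivrMr ?exprn_gt0 //.
(* Chebyshev gives [32 * r0 / (s * eps ^ 3)]; for [s = (8 * e) ^ 4 * r0] this is [1 / (128 * e)]
   divided by [(e * eps) ^ 3], which is at least 1. *)
have -> : 1 / (128 * e%:R) * dev ^+ 2 = s%:R * (2 * tau * (2 * d)) * (e%:R * eps) ^+ 3.
  by rewrite /dev /tau sE; field; rewrite !gt_eqF.
have [s_ge0 d_ge0] := (ltW s_gt0, ltW d0).
apply: ler_peMr; last exact: exprn_ege1.
by do 2! [apply: mulr_ge0 => //]; apply: mulr_ge0.
Qed.

Lemma estimate_prob (K : nat) : K = (13 * e)%N ->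
  2 / 3 <= sample_min (fun g => sample_sum draw gain s g 0) K
    (fun t => ((s%:R * ((1 - eps) * d) < t%:R) && (t%:R < s%:R * ((B + eps) * d)))%:R)
    (n * s).
Proof.
move=> KE; have hF := sample_sum_expectation gain draw_expectation s 0.
have hM := sample_min_expectation hF K (n * s).
pose up t := (s%:R * ((B + eps) * d) <= t%:R)%R%:R : R.
pose low t := (t%:R <= s%:R * ((1 - eps) * d))%R%:R : R.
apply: (@le_trans _ _ (sample_min (fun g => sample_sum draw gain s g 0) K
   (fun t => 1 - (up t + low t)) (n * s))); last first.
  apply: (exp_le hM) => t; rewrite /up /low [t%:R < _]ltNge [_ < t%:R]ltNge.
  by case: (_ <= t%:R); case: (t%:R <= _) => /=; lra.
rewrite (expB hM) (expD hM) (exp_cst hM).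
move: (eps0) (eps_lt) (e_eps) (e_gt0) => eps_gt0 eps_lt2 ee e_pos.
have upE : sample_min (fun g => sample_sum draw gain s g 0) K up (n * s) <= 1 / 6.
  have eps2 : 0 < 1 + eps / 2 by rewrite addr_gt0 // divr_gt0.
  apply: le_trans (sample_min_upper hF _ _ _ round_upper) _.
    by rewrite invr_ge0 ltW.
  apply: (@le_trans _ _ ((1 + eps / 2)^-1 ^+ K)).
    by rewrite ler_piMl ?exprn_ge0 ?invr_ge0 ?(ltW eps2) // lern1 leq_b1.
  rewrite exprVn -[1 / 6]invrK lef_pV2 ?posrE ?exprn_gt0 ?invr_gt0 //.
  (* Bernoulli's inequality: the power is at least [1 + 13 * e * eps / 2], which exceeds 6 since
     [1 <= e * eps]. *)
  have bern k : 1 + k%:R * (eps / 2) <= (1 + eps / 2) ^+ k.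
    elim: k => [|k IH]; first by rewrite mul0r addr0 expr0.
    apply: (@le_trans _ _ ((1 + eps / 2) * (1 + k%:R * (eps / 2)))).
      by have := ler0n R k; rewrite -natr1; nra.
    by rewrite exprS ler_wpM2l // ltW.
  by apply: le_trans (bern K); rewrite KE natrM; lra.
have lowE : sample_min (fun g => sample_sum draw gain s g 0) K low (n * s) <= 1 / 6.
  apply: le_trans (sample_min_lower hF _ _ round_lower) _.
  (* The initial minimum [n * s] stands for infinity: it is not too low because [d <= n]. *)
  have -> : ((n * s)%:R <= s%:R * ((1 - eps) * d))%R = false.
    apply/negbTE; rewrite -ltNge natrM mulrC ltr_pM2r //.
    apply: (@lt_le_trans _ _ d); first by rewrite gtr_pMl //; lra.
    exact: avg_degree_le.
  rewrite add0r KE natrM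
    (_ : 13 * e%:R * (1 / (128 * e%:R)) = 13 / 128); last by field; rewrite gt_eqF.
  lra.
lra.
Qed.

End Analysis.

(** * Constants of the running time and of the word size *)

Lemma running_time_le (a f e r : nat) : (0 < f)%N -> (0 < e)%N -> (0 < r)%N ->
  (3 * r + (12 * (a * f * r) + 7) * (13 * e) + 8
    <= ((12 * a + 7) * 13 + 11) * (e * f) * r)%N.
Proof.
move=> f_gt0 e_gt0 r_gt0.
have fr_gt0 : (0 < f * r)%N by rewrite muln_gt0 f_gt0.
have r_le : (r <= e * f * r)%N by rewrite leq_pmull // muln_gt0 e_gt0.
have e_le : (e <= e * f * r)%N by rewrite -mulnA leq_pmulr.
have -> : ((12 * (a * f * r) + 7) * (13 * e) = 156 * (a * (e * f * r)) + 91 * e)%N by ring.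
have -> : (((12 * a + 7) * 13 + 11) * (e * f) * r
  = 156 * (a * (e * f * r)) + 102 * (e * f * r))%N by ring.
by move: (e * f * r)%N r_le e_le => x r_le e_le; move: (a * x)%N => y; lia.
Qed.

(** The factor 64 is [2 ^ 5] from [e <= 2 / eps], times 2 from the rounding of the square root. *)
Lemma complexity_ge (R : realType) (c T e r0 n : nat) (eps : R) :
  0 < eps -> e%:R <= 2 / eps -> r0%:R <= 2 * Num.sqrt n%:R :> R ->
  (T <= c * e ^ 5 * r0)%N -> T%:R <= complexity_bound (c%:R * 64) 5 n eps.
Proof.
move=> eps0 e_le r0_le T_le.
have e5 : e%:R ^+ 5 <= 32 * (1 / eps) ^+ 5 :> R.
  apply: (@le_trans _ _ ((2 / eps) ^+ 5)).
    by rewrite lerXn2r ?nnegrE ?divr_ge0 // ltW.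
  by rewrite -[2]/(2%:R) !exprMn expr1n mul1r -natrX.
apply: (@le_trans _ _ (c%:R * (32 * (1 / eps) ^+ 5) * (2 * Num.sqrt n%:R))).
  apply: (@le_trans _ _ (c * e ^ 5 * r0)%N%:R); first by rewrite ler_nat.
  by rewrite natrM natrM natrX; apply: ler_pM => //; rewrite ler_wpM2l.
rewrite /complexity_bound.
have inv0 : 0 <= (1 / eps) ^+ 5 by rewrite exprn_ge0 // divr_ge0 // ltW.
apply: (@le_trans _ _ (c%:R * 64 * Num.sqrt n%:R * 1 * (1 / eps) ^+ 5)).
  by rewrite le_eqVlt; apply/orP; left; apply/eqP; ring.
rewrite ler_wpM2r // ler_wpM2l ?mulr_ge0 ?sqrtr_ge0 // le_max lexx //.
Qed.

(** For [x = n / eps >= 4] one has [2 * n <= x], [8 * e <= x ^ 3] and [r0 < x], so the product is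
    below [x ^ (1 + 12 + 1)]. *)
Lemma word_size_ge (R : realType) (eps : R) (n r0 e W : nat) :
  0 < eps -> eps < 1 / 2 -> e%:R <= 2 / eps -> (1 < n)%N -> (r0 <= n)%N ->
  (n%:R / eps) ^+ 14 <= W%:R -> (2 * n * ((8 * e) ^ 4 * r0) < W)%N.
Proof.
move=> eps0 eps_lt e_le n1 r0n; rewrite -(ltr_nat R); apply: lt_le_trans.
set x := n%:R / eps.
have n2 : 2 <= n%:R :> R by rewrite ler_nat.
have ex : e%:R <= x by apply: le_trans e_le _; rewrite ler_wpM2r // invr_ge0 ltW.
have nx : 2 * n%:R <= x by rewrite /x ler_pdivlMr //; nra.
clearbody x.
have x4 : 4 <= x by lra.
have x0 : 0 < x by lra.
have ex3 : 8 * e%:R <= x ^+ 3.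
  have e0 := ler0n R e; have : 8 <= x ^+ 2 by nra.
  by rewrite exprSr => x2; nra.
have r0x : r0%:R < x by apply: le_lt_trans (_ : n%:R < x); [rewrite ler_nat|lra].
rewrite -[x ^+ 14]/(x ^+ (1 + (3 * 4 + 1))) exprD exprD exprM !expr1.
rewrite natrM natrM natrM natrX natrM.
have e4 : 0 <= (8 * e%:R) ^+ 4 :> R by rewrite exprn_ge0 ?mulr_ge0.
apply: (@le_lt_trans _ _ (x * ((x ^+ 3) ^+ 4 * r0%:R))); last first.
  by rewrite ltr_pM2l // ltr_pM2l // !exprn_gt0.
apply: ler_pM => //; rewrite ?mulr_ge0 //.
rewrite ler_wpM2r //; apply: lerXn2r => //; rewrite nnegrE; first by rewrite mulr_ge0.
by rewrite exprn_ge0 // ltW.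
Qed.

Theorem theorem1p4 (R : realType) :
  exists (C : R) (k w : nat),
  forall alpha eps : R, 0 <= alpha <= 1 -> 0 < eps < 1 / 2 ->
  exists p : program,
  forall (n W : nat) (A : 'I_n -> seq (option 'I_n)),
    (n%:R / eps) ^+ w <= W%:R ->
    erased_graph alpha A ->
    1 <= avg_degree R A ->
  exists T : nat,
  [/\ T%:R <= complexity_bound C k n eps,
      surely W A (fun c => halted c &&
        ((queries c)%:R <= complexity_bound C k n eps)) T (initial W n p)
    & 2 / 3 <= prob R W A (fun c =>
        [&& halted c,
            (1 - eps) * avg_degree R A < output R c
          & output R c < (1 + 2 * Num.min alpha (1 / 2) + eps) * avg_degree R A])
        T (initial W n p)].
Proof.
(* The exponent 5 collects [e ^ 4] from the samples of a round and [e] from the number of rounds; 14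
   comes from [word_size_ge]. *)
exists (((12 * 8 ^ 4 + 7) * 13 + 11)%N%:R * 64), 5%N, 14%N => alpha eps alpha01 /andP[eps0 eps_lt].
have inv_ge0 : 0 <= 1 / eps by rewrite divr_ge0 // ltW.
have inv_ge1 : 1 <= 1 / eps by rewrite ler_pdivlMr //; lra.
pose e := (Num.truncn (1 / eps)).+1.
have /andP[e_lo e_hi] := truncn_itv inv_ge0; rewrite -/e in e_hi.
have e_le : e%:R <= 2 / eps.
  by rewrite /e -natr1; apply: (@le_trans _ _ (1 / eps + 1 / eps)); [lra|rewrite -mulrDl; lra].
(* With [e >= 1 / eps], [c = (8 e)^4] makes a round too low with probability at most
   [1 / (128 e)], so that [13 e] rounds fail with probability at most 13/128; all are
   too high with probability at most [(1 + eps / 2)^(- 13 e) <= 1 / 6].  The constant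
   [c] is kept abstract to prevent its evaluation. *)
have [c cE] : exists c : nat, c = ((8 * e) ^ 4)%N by exists ((8 * e) ^ 4)%N.
exists (estimator c (13 * e)) => n W A W_ge erasedA d_ge1.
have n_gt0 : (0 < n)%N.
  (* For [n = 0] the average degree is a quotient by 0, hence 0, against [1 <= d]. *)
  by case: n A W_ge erasedA d_ge1 => // A _ _; rewrite /avg_degree invr0 mulr0 ler10.
have d_le := avg_degree_le n_gt0 erasedA.
(* For a single vertex the total length would be 1, yet it is even. *)
have n1 : (1 < n)%N.
  have [g [L [simple_g adjL erasedL _]]] := erasedA.
  have := entry_total_edges simple_g adjL erasedL; move: d_le d_ge1.
  rewrite avg_degreeE // ler_pdivrMr ?ltr0n // ler_pdivlMr ?ltr0n // mul1r -natrM !ler_nat.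
  move=> D_le D_ge D_even; rewrite ltnNge; apply/negP => n1.
  move: D_le D_ge D_even (leq_mul n1 n1) n_gt0.
  by move: (entry_total A) (edge_count g) (n * n)%N => D m nn; clear; lia.
have [r0 r0_sq r0_min] : exists2 r0, (n <= r0 * r0)%N & forall r, (r < r0)%N -> (r * r < n)%N.
  have ex : exists r, (n <= r * r)%N by exists n; rewrite leq_pmulr.
  by exists (ex_minn ex); case: ex_minnP => // r _ min r' r'r; rewrite ltnNge; apply/negP => /min;
    rewrite leqNgt r'r.
have r0n : (r0 <= n)%N by rewrite leqNgt; apply/negP => /r0_min; rewrite ltnNge leq_pmulr.
have W_gt := word_size_ge eps0 eps_lt e_le n1 r0n W_ge.
rewrite -cE in W_gt.
have r0_gt0 : (0 < r0)%N by case: r0 r0_sq {r0_min r0n W_gt} => //; rewrite leqNgt n_gt0.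
have e_gt0 : (0 < e)%N by [].
have c_gt0 : (0 < c)%N by rewrite cE expn_gt0 muln_gt0 e_gt0.
have s_gt0 : (0 < c * r0)%N by rewrite muln_gt0 c_gt0.
(* The predecessor of [r0] is at most [sqrt n], and [1 <= sqrt n] absorbs the rounding. *)
have r0_sqrt : r0%:R <= 2 * Num.sqrt n%:R :> R.
  case: r0 r0_gt0 r0_min {r0_sq r0n W_gt s_gt0} => // r _ /(_ r (ltnSn r)) r_sq.
  have r_le : r%:R <= Num.sqrt n%:R :> R.
    rewrite -[r%:R]ger0_norm // -sqrtr_sqr ler_sqrt ?ler0n //.
    by rewrite -natrX ler_nat expnS expn1 ltnW.
  have : 1 <= Num.sqrt n%:R :> R by rewrite -[leLHS]sqrtr1 ler_wsqrtr ?ler1n.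
  by rewrite -natr1; lra.
pose T := (3 * r0 + (12 * (c * r0) + 7) * (13 * e) + 8)%N.
have T_le : T%:R <= complexity_bound (((12 * 8 ^ 4 + 7) * 13 + 11)%N%:R * 64 : R) 5 n eps.
  apply: (complexity_ge eps0 e_le r0_sqrt); rewrite /T cE expnMn [(e ^ 5)%N]expnS.
  by apply: running_time_le; rewrite ?expn_gt0 ?e_gt0.
pose M := write W (fun=> 0%N) 0 n.
have nW : (n < W)%N.
  by apply: leq_ltn_trans W_gt; rewrite (leq_trans _ (leq_pmulr _ s_gt0)) // leq_pmull.
pose good c0 := [&& halted c0, (1 - eps) * avg_degree R A < output R c0
  & output R c0 < (1 + 2 * Num.min alpha (1 / 2) + eps) * avg_degree R A].
pose g t : R :=
  (((c * r0)%:R * ((1 - eps) * avg_degree R A) < t%:R) &&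
   (t%:R < (c * r0)%:R * ((1 + 2 * Num.min alpha (1 / 2) + eps) * avg_degree R A)))%:R.
have att : attains W A good (Config (estimator c (13 * e)) M 0) T
    (sample_min (fun g => sample_sum (draw A) (gain A) (c * r0) g 0) (13 * e) g
      (n * (c * r0))).
  apply: (@attains_estimator R W n A good n_gt0 (erased_degree_le erasedA)
    c (13 * e) r0 g M 0) => //.
  - by rewrite /M /write /= modn_small.
  - by case.
  - apply: leq_ltn_trans W_gt; rewrite leq_mul ?leq_pmull //.
    by rewrite (leq_trans r0n) ?leq_pmull.
  - exact: leq_ltn_trans nW.
  - apply: leq_ltn_trans W_gt; rewrite (leq_trans (leq_pmulr c r0_gt0)) //.
    by rewrite leq_pmull // muln_gt0.
  - apply: leq_ltn_trans W_gt; apply: (@leq_trans (2 * c)%N).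
      apply: (@leq_trans (2 * (8 * e))%N); first by rewrite mulnA leq_mul2r orbT.
      by rewrite leq_mul2l cE expnS leq_pmulr // expn_gt0 muln_gt0.
    by rewrite leq_mul ?leq_pmulr.
  move=> t M' q' M'0 M'1; rewrite /g /good ler_nat /output /= M'0 M'1.
  by rewrite ltr_pdivlMr ?ltr0n // ltr_pdivrMr ?ltr0n // ![_ * (c * r0)%:R]mulrC.
exists T; split=> //.
  have := surely_and att.1 (surely_queries W A T (initial W n (estimator c (13 * e)))).
  apply: surely_sub => c0 /andP[-> qT] /=; apply: le_trans T_le.
  by rewrite ler_nat.
apply: le_trans att.2; apply: (estimate_prob n_gt0 alpha01 eps0 eps_lt erasedA d_ge1 r0_sq (e := e)) => //.
- exact: ltW.
- by rewrite natrM cE natrX natrM.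
Qed.
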